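(* Any four-dimensional subalgebra of $\mathfrak{b}$ that contains a regular semisimple element but not a Cartan subalgebra is equivalent to one of the following subalgebras, which are inequivalent apart from the equivalences noted: $$\langle T_{a,1},\mathfrak{n}_{\mathfrak{p}}\rangle\sim\langle T_{a^{-1},1},\mathfrak{n}_{\mathfrak{p}}\rangle,$$ $$\langle T_{a,1},X_{\beta},X_{\alpha+\beta},X_{\alpha+2\beta}\rangle\sim\langle T_{-a,1},X_{\beta},X_{\alpha+\beta},X_{\alpha+2\beta}\rangle,$$ $$\langle T_{3,1},X_{\alpha}+X_{\beta},X_{\alpha+\beta},X_{\alpha+2\beta}\rangle,$$ where $a\in\mathbb{C}$, $a\neq0,\pm1$.
   Context: Let $J=\begin{pmatrix}0&0&1&0\\0&0&0&1\\-1&0&0&0\\0&-1&0&0\end{pmatrix}$. $\mathfrak{sp}(4,\mathbb{C})$ is the Lie algebra of $4\times4$ complex matrices $X$ with $JX^tJ=X$, and $Sp(4,\mathbb{C})=\{g\in GL(4,\mathbb{C}) : gJg^t=J\}$, acting on $\mathfrak{sp}(4,\mathbb{C})$ by conjugation $X\mapsto gXg^{-1}$. For $a,b\in\mathbb{C}$, $T_{a,b}=\mathrm{diag}(a,b,-a,-b)$, and $\mathfrak{t}=\{T_{a,b}: a,b\in\mathbb{C}\}$. A Cartan subalgebra of $\mathfrak{sp}(4,\mathbb{C})$ is a two-dimensional subalgebra of commuting semisimple (diagonalizable) elements. A semisimple element of $\mathfrak{sp}(4,\mathbb{C})$ is regular if it has four distinct eigenvalues; $T_{a,b}$ is regular iff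 $a,b\neq0$ and $a\neq\pm b$. With $E_{ij}$ the matrix units, $X_\alpha=E_{24}$, $X_\beta=E_{12}-E_{43}$, $X_{\alpha+\beta}=E_{14}+E_{23}$, $X_{\alpha+2\beta}=E_{13}$. $\langle\,\cdot\,\rangle$ denotes the complex linear span of the listed elements and subspaces. $\mathfrak{n}_{\mathfrak{p}}=\langle X_\alpha,X_{\alpha+\beta},X_{\alpha+2\beta}\rangle$, and $\mathfrak{b}=\mathfrak{t}\oplus\langle X_\alpha,X_\beta,X_{\alpha+\beta},X_{\alpha+2\beta}\rangle$ is the Borel subalgebra. Two subalgebras are equivalent, written $\sim$, if some $g\in Sp(4,\mathbb{C})$ conjugates one onto the other. *)

(* Defs.v *)
From HB Require Import structures.
From mathcomp Require Import all_boot all_order all_algebra.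
From mathcomp Require Export reals complex.

Set Implicit Arguments.
Unset Strict Implicit.
Unset Printing Implicit Defensive.

Import GRing.Theory.
Local Open Scope ring_scope.

Definition J4 {F : fieldType} : 'M[F]_4 :=
  block_mx 0 1%:M (- 1%:M) 0 : 'M[F]_(2 + 2).

Definition sp4 {F : fieldType} : {pred 'M[F]_4} :=
  [pred X | J4 *m X^T *m J4 == X].

Definition Sp4 {F : fieldType} : {pred 'M[F]_4} :=
  [pred g | (g \in unitmx) && (g *m J4 *m g^T == J4)].

Definition lie_bracket {F : fieldType} (X Y : 'M[F]_4) : 'M[F]_4 :=
  X *m Y - Y *m X.

Definition lie_subalgebra {F : fieldType} (S : {vspace 'M[F]_4}) : Prop :=
  {subset S <= sp4} /\ {in S &, forall X Y, lie_bracket X Y \in S}.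

(* Rows and columns are numbered from 1, as in E_{24}; hence the [.-1]. *)
Definition Emx {F : fieldType} (i j : nat) : 'M[F]_4 :=
  delta_mx (inord i.-1) (inord j.-1).

Definition Tmx {F : fieldType} (a b : F) : 'M[F]_4 :=
  a *: Emx 1 1 + b *: Emx 2 2 - a *: Emx 3 3 - b *: Emx 4 4.

Definition X_alpha {F : fieldType} : 'M[F]_4 := Emx 2 4.
Definition X_beta {F : fieldType} : 'M[F]_4 := Emx 1 2 - Emx 4 3.
Definition X_alpha_beta {F : fieldType} : 'M[F]_4 := Emx 1 4 + Emx 2 3.
Definition X_alpha_2beta {F : fieldType} : 'M[F]_4 := Emx 1 3.

Definition t_diag {F : fieldType} : {vspace 'M[F]_4} :=
  <<[:: Tmx 1 0; Tmx 0 1]>>%VS.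

Lemma mem_t_diag (F : fieldType) (X : 'M[F]_4) :
  X \in t_diag <-> exists a b : F, X = Tmx a b.
Proof.
have TE (a b : F) : Tmx a b = a *: Tmx 1 0 + b *: Tmx 0 1.
  rewrite /Tmx !scale1r !scale0r !subr0 !addr0 add0r !scalerBr.
  by rewrite -[LHS]addrA addrACA.
rewrite /t_diag span_cons span_seq1; split.
  case/memv_addP=> _ /vlineP[a ->] [_ /vlineP[b ->] ->].
  by exists a, b; rewrite [RHS]TE.
case=> a [b ->]; rewrite TE.
by apply: memv_add; apply: memvZ; apply: memv_line.
Qed.

Definition n_p {F : fieldType} : {vspace 'M[F]_4} :=
  <<[:: X_alpha; X_alpha_beta; X_alpha_2beta]>>%VS.

Definition borel {F : fieldType} : {vspace 'M[F]_4} :=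
  (t_diag + <<[:: X_alpha; X_beta; X_alpha_beta; X_alpha_2beta]>>)%VS.

Definition cartan_subalgebra {F : fieldType} (H : {vspace 'M[F]_4}) : Prop :=
  [/\ lie_subalgebra H, \dim H = 2%N,
      {in H &, forall X Y, X *m Y = Y *m X}
    & {in H, forall X, diagonalizable X}].

Definition regular_semisimple {F : fieldType} (X : 'M[F]_4) : Prop :=
  [/\ X \in sp4, diagonalizable X
    & exists s : seq F, [/\ size s = 4%N, uniq s & all (eigenvalue X) s]].

(* [g S g^-1 = S'] for some [g] in [Sp(4)]. *)
Definition Sp4_equiv {F : fieldType} (S S' : {vspace 'M[F]_4}) : Prop :=
  exists2 g : 'M[F]_4, g \in Sp4 &
    forall Y, Y \in S' <-> exists2 X, X \in S & Y = g *m X *m invmx g.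

Definition fam_np {F : fieldType} (a : F) : {vspace 'M[F]_4} :=
  (<[Tmx a 1%R]> + n_p)%VS.

Definition fam_beta {F : fieldType} (a : F) : {vspace 'M[F]_4} :=
  <<[:: Tmx a 1%R; X_beta; X_alpha_beta; X_alpha_2beta]>>%VS.

Definition alg_mixed {F : fieldType} : {vspace 'M[F]_4} :=
  <<[:: Tmx 3%R 1%R; (X_alpha + X_beta)%R; X_alpha_beta; X_alpha_2beta]>>%VS.

Definition admissible {F : fieldType} (a : F) : Prop :=
  [/\ a != 0, a != 1 & a != -1].

(* Main.v *)
Require Import Defs.
From mathcomp Require Import all_boot all_order all_algebra.
From mathcomp Require Import boolp ring.

Set Implicit Arguments.
Unset Strict Implicit.
Unset Printing Implicit Defensive.

Import GRing.Theory.
Local Open Scope ring_scope.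

(* A regular semisimple element of b is conjugate, by the unipotent radical of
   the Borel subgroup, to some T = T_{a,b}.  Since ad T is invertible on the
   nilradical n, a polynomial in ad T projects S onto S :&: t, which is the line
   <T> because S contains no Cartan subalgebra; hence S = <T> + N with N a
   three-dimensional subalgebra of n.  The image of N in n / [n, n] is a line
   spanned by x X_alpha + y X_beta, for otherwise N = n; so N contains [n, n],
   and ad T preserves the line only if x = 0, y = 0 or a = 3 b.  A torus element
   normalizes the last case.

   For the inequivalences, a conjugation carries nilpotent elements to nilpotent
   elements.  Those of <T_{a,1}, n_p> multiply to zero pairwise, those of
   <T_{a,1}, X_beta, ...> square to zero but do not all commute, and
   X_alpha + X_beta does not square to zero.  Within the first family g must
   preserve the common kernel <e_1, e_2> of n_p, and T_{a,1} acts there with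
   eigenvalues a and 1; within the second it preserves the line <e_1>, where
   T_{a,1} acts by a, and T_{a,1} acts by 1 and -1 on the remaining plane
   <e_2, e_4>. *)

(** * Explicit 4 x 4 matrices *)

Section Matrices4.
Variable F : fieldType.

(** Sixteen named entries turn a matrix identity into [congr M4; ring], and [M4_inj] reads equations
    back entry by entry. *)
Definition M4 (a11 a12 a13 a14 a21 a22 a23 a24
    a31 a32 a33 a34 a41 a42 a43 a44 : F) : 'M[F]_4 :=
  \matrix_(i, j) nth 0 (nth [::]
    [:: [:: a11; a12; a13; a14]; [:: a21; a22; a23; a24];
        [:: a31; a32; a33; a34]; [:: a41; a42; a43; a44]] i) j.

Let i1 : 'I_4 := @Ordinal 4 0 isT.
Let i2 : 'I_4 := @Ordinal 4 1 isT.
Let i3 : 'I_4 := @Ordinal 4 2 isT.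
Let i4 : 'I_4 := @Ordinal 4 3 isT.

Lemma ord4P (P : 'I_4 -> Prop) : P i1 -> P i2 -> P i3 -> P i4 -> forall i, P i.
Proof.
move=> P1 P2 P3 P4 [[|[|[|[|//]]]] lti].
- by rewrite (_ : Ordinal _ = i1) //; apply: val_inj.
- by rewrite (_ : Ordinal _ = i2) //; apply: val_inj.
- by rewrite (_ : Ordinal _ = i3) //; apply: val_inj.
- by rewrite (_ : Ordinal _ = i4) //; apply: val_inj.
Qed.

Lemma sum4E (V : nmodType) (f : 'I_4 -> V) :
  \sum_i f i = f i1 + f i2 + f i3 + f i4.
Proof.
rewrite !big_ord_recl big_ord0 addr0 !addrA.
by congr (f _ + f _ + f _ + f _); apply: val_inj.
Qed.

Lemma M4_ex (X : 'M[F]_4) : exists a11 a12 a13 a14 a21 a22 a23 a24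
    a31 a32 a33 a34 a41 a42 a43 a44,
  X = M4 a11 a12 a13 a14 a21 a22 a23 a24
         a31 a32 a33 a34 a41 a42 a43 a44.
Proof.
exists (X i1 i1), (X i1 i2), (X i1 i3), (X i1 i4), (X i2 i1), (X i2 i2),
  (X i2 i3), (X i2 i4), (X i3 i1), (X i3 i2), (X i3 i3), (X i3 i4),
  (X i4 i1), (X i4 i2), (X i4 i3), (X i4 i4).
by apply/matrixP => i j; rewrite mxE; elim/ord4P: i; elim/ord4P: j.
Qed.

Lemma M4_mul a11 a12 a13 a14 a21 a22 a23 a24
    a31 a32 a33 a34 a41 a42 a43 a44
    b11 b12 b13 b14 b21 b22 b23 b24
    b31 b32 b33 b34 b41 b42 b43 b44 :
  M4 a11 a12 a13 a14 a21 a22 a23 a24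
     a31 a32 a33 a34 a41 a42 a43 a44 *m
  M4 b11 b12 b13 b14 b21 b22 b23 b24
     b31 b32 b33 b34 b41 b42 b43 b44 =
  M4 (a11 * b11 + a12 * b21 + a13 * b31 + a14 * b41)
     (a11 * b12 + a12 * b22 + a13 * b32 + a14 * b42)
     (a11 * b13 + a12 * b23 + a13 * b33 + a14 * b43)
     (a11 * b14 + a12 * b24 + a13 * b34 + a14 * b44)
     (a21 * b11 + a22 * b21 + a23 * b31 + a24 * b41)
     (a21 * b12 + a22 * b22 + a23 * b32 + a24 * b42)
     (a21 * b13 + a22 * b23 + a23 * b33 + a24 * b43)
     (a21 * b14 + a22 * b24 + a23 * b34 + a24 * b44)
     (a31 * b11 + a32 * b21 + a33 * b31 + a34 * b41)
     (a31 * b12 + a32 * b22 + a33 * b32 + a34 * b42)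
     (a31 * b13 + a32 * b23 + a33 * b33 + a34 * b43)
     (a31 * b14 + a32 * b24 + a33 * b34 + a34 * b44)
     (a41 * b11 + a42 * b21 + a43 * b31 + a44 * b41)
     (a41 * b12 + a42 * b22 + a43 * b32 + a44 * b42)
     (a41 * b13 + a42 * b23 + a43 * b33 + a44 * b43)
     (a41 * b14 + a42 * b24 + a43 * b34 + a44 * b44).
Proof.
by apply/matrixP => i j; rewrite mxE sum4E !mxE /=; elim/ord4P: i; elim/ord4P: j.
Qed.

Lemma M4_add a11 a12 a13 a14 a21 a22 a23 a24
    a31 a32 a33 a34 a41 a42 a43 a44
    b11 b12 b13 b14 b21 b22 b23 b24
    b31 b32 b33 b34 b41 b42 b43 b44 :
  M4 a11 a12 a13 a14 a21 a22 a23 a24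
     a31 a32 a33 a34 a41 a42 a43 a44 +
  M4 b11 b12 b13 b14 b21 b22 b23 b24
     b31 b32 b33 b34 b41 b42 b43 b44 =
  M4 (a11 + b11) (a12 + b12) (a13 + b13) (a14 + b14)
     (a21 + b21) (a22 + b22) (a23 + b23) (a24 + b24)
     (a31 + b31) (a32 + b32) (a33 + b33) (a34 + b34)
     (a41 + b41) (a42 + b42) (a43 + b43) (a44 + b44).
Proof. by apply/matrixP => i j; rewrite !mxE; elim/ord4P: i; elim/ord4P: j. Qed.

Lemma M4_scale c a11 a12 a13 a14 a21 a22 a23 a24
    a31 a32 a33 a34 a41 a42 a43 a44 :
  c *: M4 a11 a12 a13 a14 a21 a22 a23 a24
     a31 a32 a33 a34 a41 a42 a43 a44 =
  M4 (c * a11) (c * a12) (c * a13) (c * a14)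
     (c * a21) (c * a22) (c * a23) (c * a24)
     (c * a31) (c * a32) (c * a33) (c * a34)
     (c * a41) (c * a42) (c * a43) (c * a44).
Proof. by apply/matrixP => i j; rewrite !mxE; elim/ord4P: i; elim/ord4P: j. Qed.

Lemma M4_opp a11 a12 a13 a14 a21 a22 a23 a24
    a31 a32 a33 a34 a41 a42 a43 a44 :
  - M4 a11 a12 a13 a14 a21 a22 a23 a24
     a31 a32 a33 a34 a41 a42 a43 a44 =
  M4 (- a11) (- a12) (- a13) (- a14)
     (- a21) (- a22) (- a23) (- a24)
     (- a31) (- a32) (- a33) (- a34)
     (- a41) (- a42) (- a43) (- a44).
Proof. by apply/matrixP => i j; rewrite !mxE; elim/ord4P: i; elim/ord4P: j. Qed.

Lemma M4_tr a11 a12 a13 a14 a21 a22 a23 a24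
    a31 a32 a33 a34 a41 a42 a43 a44 :
  (M4 a11 a12 a13 a14 a21 a22 a23 a24
     a31 a32 a33 a34 a41 a42 a43 a44)^T =
  M4 a11 a21 a31 a41 a12 a22 a32 a42 a13 a23 a33 a43 a14 a24 a34 a44.
Proof. by apply/matrixP => i j; rewrite !mxE; elim/ord4P: i; elim/ord4P: j. Qed.

Lemma M4_0 : 0 = M4 0 0 0 0 0 0 0 0 0 0 0 0 0 0 0 0.
Proof. by apply/matrixP => i j; rewrite !mxE; elim/ord4P: i; elim/ord4P: j. Qed.

Lemma M4_1 : 1%:M = M4 1 0 0 0 0 1 0 0 0 0 1 0 0 0 0 1.
Proof. by apply/matrixP => i j; rewrite !mxE; elim/ord4P: i; elim/ord4P: j. Qed.

Lemma M4_J : J4 = M4 0 0 1 0 0 0 0 1 (-1) 0 0 0 0 (-1) 0 0.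
Proof.
apply/matrixP => i j; rewrite /J4 !mxE.
case: splitP => [] [[|[|//]]] ? /= ->; rewrite !mxE.
all: case: splitP => [] [[|[|//]]] ? /= ->; rewrite !mxE -?val_eqE //=.
all: by rewrite oppr0.
Qed.

Lemma M4_inj a11 a12 a13 a14 a21 a22 a23 a24
    a31 a32 a33 a34 a41 a42 a43 a44
    b11 b12 b13 b14 b21 b22 b23 b24
    b31 b32 b33 b34 b41 b42 b43 b44 :
  M4 a11 a12 a13 a14 a21 a22 a23 a24
     a31 a32 a33 a34 a41 a42 a43 a44 =
  M4 b11 b12 b13 b14 b21 b22 b23 b24
     b31 b32 b33 b34 b41 b42 b43 b44 ->
  [/\ [/\ a11 = b11, a12 = b12, a13 = b13 & a14 = b14],
      [/\ a21 = b21, a22 = b22, a23 = b23 & a24 = b24],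
      [/\ a31 = b31, a32 = b32, a33 = b33 & a34 = b34]
    & [/\ a41 = b41, a42 = b42, a43 = b43 & a44 = b44]].
Proof.
move=> /matrixP AB.
move: (AB i1 i1) (AB i1 i2) (AB i1 i3) (AB i1 i4)
  (AB i2 i1) (AB i2 i2) (AB i2 i3) (AB i2 i4)
  (AB i3 i1) (AB i3 i2) (AB i3 i3) (AB i3 i4)
  (AB i4 i1) (AB i4 i2) (AB i4 i3) (AB i4 i4).
by rewrite !mxE /=; do !split.
Qed.

(** General element of [borel]: torus coordinates [a], [b], then the coefficients of the root
    vectors for alpha, beta, alpha + beta and alpha + 2 beta. *)
Definition bmat (a b x y z w : F) : 'M[F]_4 :=
  M4 a y w z  0 b z x  0 0 (- a) 0  0 0 (- y) (- b).

Lemma bmatE a b x y z w :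
  Tmx a b + (x *: X_alpha + y *: X_beta) + z *: X_alpha_beta
    + w *: X_alpha_2beta = bmat a b x y z w.
Proof.
rewrite /bmat /Tmx /X_alpha /X_beta /X_alpha_beta /X_alpha_2beta /Emx.
apply/matrixP => i j; rewrite !mxE -!val_eqE /= !inordK //.
elim/ord4P: i; elim/ord4P: j => /=; ring.
Qed.

End Matrices4.

(** * The symplectic algebra and its Borel subalgebra *)

Section Subalgebras.
Variable F : fieldType.
Implicit Types (X Y g h : 'M[F]_4) (S : {vspace 'M[F]_4}).

Definition M4E := (@M4_mul F, @M4_add F, @M4_opp F, @M4_scale F, @M4_tr F).

Lemma borel_bmat X : X \in borel ->
  exists a b x y z w, X = bmat a b x y z w.
Proof.
case/memv_addP => _ /mem_t_diag[a [b ->]] [V].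
rewrite !span_cons span_nil addv0.
case/memv_addP=> _ /vlineP[x ->] [_ /memv_addP[_ /vlineP[y ->] [W + ->]] ->] ->.
case/memv_addP=> _ /vlineP[z ->] [_ /vlineP[w ->] ->].
by exists a, b, x, y, z, w; rewrite -bmatE !addrA.
Qed.

Lemma bmat_borel a b x y z w : bmat a b x y z w \in (borel : {vspace 'M[F]_4}).
Proof.
rewrite -bmatE -!(addrA (Tmx a b)) memv_add //.
  by apply/mem_t_diag; exists a, b.
by rewrite !memvD // memvZ // memv_span // !inE eqxx ?orbT.
Qed.

(** Common form of the three listed types, for (x, y) = (1, 0), (0, 1) and (1, 1). *)
Definition fam (a b x y : F) : {vspace 'M[F]_4} :=
  <<[:: Tmx a b; (x *: X_alpha + y *: X_beta)%R; X_alpha_beta; X_alpha_2beta]>>%VS.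

Lemma TmxZ (c a b : F) : c *: Tmx a b = Tmx (c * a) (c * b).
Proof. by rewrite /Tmx !scalerBr !scalerDr !scalerA. Qed.

Lemma mem_fam a b x y X : X \in fam a b x y <->
  exists c u z w, X = bmat (c * a) (c * b) (u * x) (u * y) z w.
Proof.
have E c u z w : c *: Tmx a b + (u *: (x *: X_alpha + y *: X_beta)
    + (z *: X_alpha_beta + w *: X_alpha_2beta))
  = bmat (c * a) (c * b) (u * x) (u * y) z w.
  by rewrite -bmatE TmxZ scalerDr !scalerA !addrA.
rewrite /fam !span_cons span_nil addv0; split=> [|[c [u [z [w ->]]]]].
  case/memv_addP=> _ /vlineP[c ->] [_ /memv_addP[_ /vlineP[u ->] [W + ->]] ->].
  case/memv_addP=> _ /vlineP[z ->] [_ /vlineP[w ->] ->].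
  by exists c, u, z, w.
by rewrite -E !memv_add // memvZ // memv_line.
Qed.

Lemma dim_fam a b x y : (\dim (fam a b x y) <= 4)%N.
Proof. exact: dim_span. Qed.

Lemma fam_npE a : fam_np a = fam a 1 1 0.
Proof. by rewrite /fam_np /n_p -span_cons /fam scale1r scale0r addr0. Qed.

Lemma fam_betaE a : fam_beta a = fam a 1 0 1.
Proof. by rewrite /fam_beta /fam scale1r scale0r add0r. Qed.

Lemma alg_mixedE : alg_mixed = fam 3 1 1 1.
Proof. by rewrite /alg_mixed /fam !scale1r. Qed.

Lemma bmat_sp4 a b x y z w : bmat a b x y z w \in @sp4 F.
Proof.
apply/eqP; rewrite /bmat M4_J !M4E.
by congr M4; ring.
Qed.

(** The factors 2b, a - b, a + b and 2a are the positive roots evaluated at [Tmx a b]; the other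
    terms come from brackets with [X_beta]. *)
Lemma bmat_bracket a b x y z w a' b' x' y' z' w' :
  lie_bracket (bmat a b x y z w) (bmat a' b' x' y' z' w') =
  bmat 0 0 (2 * (b * x' - b' * x)) ((a - b) * y' - (a' - b') * y)
    ((a + b) * z' - (a' + b') * z + y * x' - y' * x)
    (2 * (a * w' - a' * w + y * z' - y' * z)) :> 'M[F]_4.
Proof. by rewrite /lie_bracket /bmat !M4E; congr M4; ring. Qed.

(** A bracket has no torus part, and its alpha and beta coordinates are a multiple of (2b x, (a - b)
    y). Each alternative makes this pair proportional to (x, y). *)
Lemma lie_fam a b x y : [\/ x = 0, y = 0 | a = 3 * b] ->
  lie_subalgebra (fam a b x y).
Proof.
move=> xyab; split=> [X /mem_fam[c [u [z [w ->]]]]|]; first exact: bmat_sp4.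
move=> X Y /mem_fam[c [u [z [w ->]]]] /mem_fam[c' [u' [z' [w' ->]]]].
apply/mem_fam; rewrite bmat_bracket.
case: xyab => [->|->|->].
- exists 0, ((c * a - c * b) * u' - (c' * a - c' * b) * u).
  by do 2!eexists; congr bmat; try reflexivity; ring.
- exists 0, (2 * (c * b * u' - c' * b * u)).
  by do 2!eexists; congr bmat; try reflexivity; ring.
- exists 0, (2 * (c * b * u' - c' * b * u)).
  by do 2!eexists; congr bmat; try reflexivity; ring.
Qed.

(** * Conjugation by the symplectic group *)

Lemma Sp4_unit g : g \in Sp4 -> g \in unitmx.
Proof. by case/andP. Qed.

Lemma J4_sqr : J4 *m J4 = - 1%:M :> 'M[F]_4.
Proof. by rewrite M4_1 M4_J !M4E; congr M4; ring. Qed.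

Lemma Sp4_invE g : g \in Sp4 -> invmx g = - (J4 *m g^T *m J4).
Proof.
case/andP=> gu /eqP gJ; rewrite -[LHS]mulmx1; apply: (canLR (mulKmx gu)).
by rewrite mulmxN !mulmxA gJ J4_sqr opprK.
Qed.

Lemma Sp4_tr_J g : g \in Sp4 -> J4 *m g^T = invmx g *m J4.
Proof.
by move=> gS; rewrite Sp4_invE // mulNmx -(mulmxA _ J4) J4_sqr mulmxN mulmx1 opprK.
Qed.

Lemma Sp4_inv g : g \in Sp4 -> invmx g \in Sp4.
Proof.
move=> gS; have gu := Sp4_unit gS; apply/andP; split; first by rewrite unitmx_inv.
by rewrite -Sp4_tr_J // -mulmxA -trmx_mul mulVmx // trmx1 mulmx1.
Qed.

Lemma Sp4_mul g h : g \in Sp4 -> h \in Sp4 -> g *m h \in Sp4.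
Proof.
move=> /andP[gu /eqP gJ] /andP[hu /eqP hJ]; apply/andP; split.
  by rewrite unitmx_mul gu.
by rewrite trmx_mul !mulmxA -(mulmxA g) -(mulmxA g) hJ gJ.
Qed.

(** For symplectic g, the map sending X to J X^T J commutes with conjugation by g, so its fixed
    points are preserved. *)
Lemma Sp4_conj_sp4 g X : g \in Sp4 -> X \in sp4 -> g *m X *m invmx g \in sp4.
Proof.
move=> gS /eqP XE; apply/eqP; have gu := Sp4_unit gS.
have gJ : J4 *m (invmx g)^T = g *m J4.
  by rewrite Sp4_tr_J ?Sp4_inv // invmxK.
have gJ' : g^T *m J4 = J4 *m invmx g.
  by rewrite [in RHS]Sp4_invE // mulmxN !mulmxA J4_sqr mulNmx mul1mx mulNmx opprK.
by rewrite !trmx_mul !mulmxA gJ -[X in X = _]mulmxA gJ' -[in RHS]XE !mulmxA.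
Qed.

(** The conjugate is built as a linear image, so that it is again a vector space with a
    dimension. *)
Definition conjS g S : {vspace 'M[F]_4} :=
  (linfun (mulmxr (invmx g) \o mulmx g) @: S)%VS.

Lemma mem_conjS g S Y :
  Y \in conjS g S <-> exists2 X, X \in S & Y = g *m X *m invmx g.
Proof.
split=> [/memv_imgP[X XS ->]|[X XS ->]]; first by exists X; rewrite // lfunE.
by apply/memv_imgP; exists X; rewrite // lfunE.
Qed.

Lemma conjK g X : g \in unitmx -> invmx g *m (g *m X *m invmx g) *m g = X.
Proof. by move=> gu; rewrite !mulmxA mulVmx // mul1mx mulmxKV. Qed.

Lemma conjVK g X : g \in unitmx -> g *m (invmx g *m X *m g) *m invmx g = X.
Proof. by move=> gu; rewrite !mulmxA mulmxV // mul1mx mulmxK. Qed.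

Lemma dim_conjS g S : g \in unitmx -> \dim (conjS g S) = \dim S.
Proof.
move=> gu; apply: limg_dim_eq; apply/eqP; rewrite -subv0; apply/subvP => X.
rewrite memv_cap memv_ker lfunE /= memv0 => /andP[_ /eqP X0].
by rewrite -(conjK X gu) X0 mulmx0 mul0mx.
Qed.

Lemma lie_bracket_conj g X Y : g \in unitmx ->
  lie_bracket (g *m X *m invmx g) (g *m Y *m invmx g)
    = g *m lie_bracket X Y *m invmx g.
Proof.
move=> gu; rewrite /lie_bracket mulmxBr mulmxBl !mulmxA.
by rewrite !mulmxKV.
Qed.

Lemma lie_conjS g S : g \in Sp4 -> lie_subalgebra S -> lie_subalgebra (conjS g S).
Proof.
move=> gS [Ssp Sbr]; split=> [_ /mem_conjS[X XS ->]|].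
  exact: Sp4_conj_sp4 (Ssp _ XS).
move=> _ _ /mem_conjS[X XS ->] /mem_conjS[Y YS ->].
apply/mem_conjS; exists (lie_bracket X Y); first exact: Sbr.
by rewrite lie_bracket_conj // Sp4_unit.
Qed.

Lemma Sp4_equiv_conjS g S : g \in Sp4 -> Sp4_equiv S (conjS g S).
Proof. by move=> gS; exists g => // Y; apply: mem_conjS. Qed.

Lemma Sp4_equiv_trans S1 S2 S3 :
  Sp4_equiv S1 S2 -> Sp4_equiv S2 S3 -> Sp4_equiv S1 S3.
Proof.
case=> g gS S12 [h hS S23]; have [gu hu] := (Sp4_unit gS, Sp4_unit hS).
exists (h *m g) => [|Z]; first exact: Sp4_mul.
have E X : h *m g *m X *m invmx (h *m g) = h *m (g *m X *m invmx g) *m invmx h.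
  have -> : invmx (h *m g) = invmx g *m invmx h by exact: (invrM hu gu).
  by rewrite !mulmxA.
split=> [/S23[_ /S12[X XS ->] ->]|[X XS ->]]; first by exists X; rewrite ?E.
by apply/S23; exists (g *m X *m invmx g); rewrite ?E //; apply/S12; exists X.
Qed.

Lemma Sp4_equiv_of g S S' : g \in Sp4 ->
    {in S, forall X, g *m X *m invmx g \in S'} ->
    {in S', forall Y, invmx g *m Y *m g \in S} -> Sp4_equiv S S'.
Proof.
move=> gS gSS' gS'S; exists g => // Y; split=> [YS|[X XS ->]]; last exact: gSS'.
exists (invmx g *m Y *m g); first exact: gS'S.
by rewrite conjVK // Sp4_unit.
Qed.

(** * Conjugates of the diagonal Cartan subalgebra *)

Lemma Tmx_bmat a b : Tmx a b = bmat a b 0 0 0 0 :> 'M[F]_4.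
Proof. by rewrite -bmatE !scale0r !addr0. Qed.

Lemma diagonalizable_conj_Tmx g a b : g \in unitmx ->
  diagonalizable (invmx g *m Tmx a b *m g).
Proof.
move=> gu; exists g => //; rewrite /similar_to mxred.conjumx // conjVK //.
apply/is_diag_mxP; rewrite Tmx_bmat => i j; rewrite mxE.
by elim/ord4P: i; elim/ord4P: j; rewrite /= ?oppr0.
Qed.

Lemma dim_t_diag : \dim (t_diag : {vspace 'M[F]_4}) = 2.
Proof.
have: free [tuple Tmx 1 0; Tmx 0 1 : 'M[F]_4]; last by rewrite /free => /eqP.
apply/freeP => k.
rewrite !big_ord_recl big_ord0 addr0 /= !TmxZ !Tmx_bmat /bmat M4E M4_0.
case/M4_inj=> [[+ _ _ _] [_ + _ _] _ _].
rewrite !(mulr1, mulr0, addr0, add0r) => k0 k1.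
case=> [[|[|//]]] lti; first by rewrite -[RHS]k0; congr k; apply: val_inj.
by rewrite -[RHS]k1; congr k; apply: val_inj.
Qed.

Lemma cartan_t_conj g : g \in Sp4 -> cartan_subalgebra (conjS (invmx g) t_diag).
Proof.
move=> gS; have gu := Sp4_unit gS; have gVS := Sp4_inv gS.
have comm a b a' b' : Tmx a b *m Tmx a' b' = Tmx a' b' *m Tmx a b :> 'M[F]_4.
  by rewrite !Tmx_bmat /bmat !M4E; congr M4; ring.
split.
- apply: lie_conjS => //; split=> [_ /mem_t_diag[a [b ->]]|].
    by rewrite Tmx_bmat bmat_sp4.
  move=> _ _ /mem_t_diag[a [b ->]] /mem_t_diag[a' [b' ->]].
  by rewrite /lie_bracket comm subrr mem0v.
- by rewrite dim_conjS ?unitmx_inv // dim_t_diag.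
- move=> _ _ /mem_conjS[_ /mem_t_diag[a [b ->]] ->]
    /mem_conjS[_ /mem_t_diag[a' [b' ->]] ->].
  by rewrite !mulmxA !mulmxKV ?unitmx_inv // -!(mulmxA (invmx g)) comm.
- move=> _ /mem_conjS[_ /mem_t_diag[a [b ->]] ->].
  by rewrite invmxK; apply: diagonalizable_conj_Tmx.
Qed.

(** If the conjugate by g contained all of t, then S would contain the Cartan subalgebra g^-1 t
    g. *)
Lemma no_cartan_Tmx g S : g \in Sp4 ->
    ~ (exists2 H, cartan_subalgebra H & (H <= S)%VS) ->
  ~ (forall a b, Tmx a b \in conjS g S).
Proof.
move=> gS noH tS; have gu := Sp4_unit gS; apply: noH.
exists (conjS (invmx g) t_diag); first exact: cartan_t_conj.
apply/subvP => _ /mem_conjS[_ /mem_t_diag[a [b ->]] ->].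
have /mem_conjS[X XS ->] := tS a b.
by rewrite invmxK conjK.
Qed.

End Subalgebras.

(** * Regular elements of the Borel subalgebra *)

Section RegularElements.
Variable F : fieldType.
Implicit Types (X Y g h : 'M[F]_4) (S : {vspace 'M[F]_4}).

(** The matrix is triangular once the last two basis vectors are swapped: the equations for a row
    eigenvector, taken in the order 1, 2, 4, 3, kill its coordinates one at a time. *)
Lemma eigenvalue_bmat (a b x y z w l : F) :
  eigenvalue (bmat a b x y z w) l -> l \in [:: a; b; - a; - b].
Proof.
case/eigenvalueP=> v /rowP vE; apply: contra_neqT.
rewrite !inE !negb_or => /and4P[la lb lNa lNb].
have eq0 c t : l != c -> t * c = l * t -> t = 0.
  move=> lc /eqP; rewrite mulrC -subr_eq0 -mulrBl mulf_eq0 subr_eq0 eq_sym.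
  by rewrite (negPf lc) => /eqP.
apply/rowP => i; rewrite [RHS]mxE.
have := vE (Ordinal (isT : (0 < 4)%N)); have := vE (Ordinal (isT : (1 < 4)%N)).
have := vE (Ordinal (isT : (2 < 4)%N)); have := vE (Ordinal (isT : (3 < 4)%N)).
rewrite !mxE !sum4E !mxE /= !(mulr0, addr0, add0r) => + + + /(eq0 _ _ la) v1.
rewrite v1 !(mul0r, add0r) => + + /(eq0 _ _ lb) v2.
rewrite v2 !(mul0r, add0r) => /(eq0 _ _ lNb) v4.
rewrite v4 !(mul0r, addr0) => /(eq0 _ _ lNa) v3.
elim/ord4P: i; [exact: v1 | exact: v2 | exact: v3 | exact: v4].
Qed.

(** Four distinct eigenvalues lie in a list of length four, which therefore has no repetition. *)
Lemma regular_bmat (a b x y z w : F) : regular_semisimple (bmat a b x y z w) ->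
  uniq [:: a; b; - a; - b].
Proof.
case=> _ _ [s [s4 us /allP sE]].
apply: leq_size_uniq us _ _ => [l /sE|]; last by rewrite s4.
exact: eigenvalue_bmat.
Qed.

(** No positive root vanishes at [Tmx a b]. The factors 2 also record that 2 is nonzero in the
    arbitrary field [F]. *)
Definition regular (a b : F) : Prop :=
  [/\ 2 * a != 0, 2 * b != 0, a - b != 0 & a + b != 0].

Lemma uniq_regular (a b : F) : uniq [:: a; b; - a; - b] -> regular a b.
Proof.
rewrite /= !inE !negb_or => /and4P[/and3P[ab aNa aNb] /andP[_ bNb] _ _].
split.
- by rewrite mulr_natl mulr2n -[X in _ + X]opprK subr_eq0.
- by rewrite mulr_natl mulr2n -[X in _ + X]opprK subr_eq0.
- by rewrite subr_eq0.
- by rewrite -[X in _ + X]opprK subr_eq0.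
Qed.

(** The product of 1 + p X_beta and 1 + q X_alpha + r X_{alpha+beta} + s X_{alpha+2beta}, in this
    order. *)
Definition unip (p q r s : F) : 'M[F]_4 :=
  M4 1 p (s + p * r) (r + p * q) 0 1 r q 0 0 1 0 0 0 (- p) 1.

Lemma unip_Sp4 p q r s : unip p q r s \in Sp4.
Proof.
have U1 : unip p q r s *m M4 1 (- p) (- (s + r * p)) (- r)
   0 1 (- (r + q * p)) (- q) 0 0 1 0 0 0 p 1 = 1%:M.
  by rewrite /unip M4E M4_1; congr M4; ring.
apply/andP; split; first by case: (mulmx1_unit U1).
by apply/eqP; rewrite /unip M4_J !M4E; congr M4; ring.
Qed.

Lemma invmx_eq g h : g *m h = 1%:M -> invmx g = h.
Proof.
move=> gh; have [gu _] := mulmx1_unit gh.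
by rewrite -[LHS]mulmx1 -gh mulKmx.
Qed.

Lemma unip_inv p q r s : invmx (unip p q r s) =
  M4 1 (- p) (- (s + r * p)) (- r) 0 1 (- (r + q * p)) (- q) 0 0 1 0 0 0 p 1.
Proof. by apply: invmx_eq; rewrite /unip M4E M4_1; congr M4; ring. Qed.

Lemma unip_borel p q r s X : X \in borel ->
  unip p q r s *m X *m invmx (unip p q r s) \in borel.
Proof.
case/borel_bmat=> [a [b [x [y [z [w ->]]]]]].
rewrite unip_inv.
suff [z' [w' ->]] : exists z' w', unip p q r s *m bmat a b x y z w *m
    M4 1 (- p) (- (s + r * p)) (- r) 0 1 (- (r + q * p)) (- q)
       0 0 1 0 0 0 p 1 =
    bmat a b (x - 2 * b * q) (y + (b - a) * p) z' w'.
  exact: bmat_borel.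
(* The last two coordinates stay open and are read off the product by [reflexivity]. *)
do 2!eexists; rewrite /unip /bmat !M4E.
by congr M4; first [reflexivity | ring].
Qed.

Lemma conj_regular (a b x y z w : F) : regular a b ->
  exists2 U, U \in Sp4 & (forall X, X \in borel -> U *m X *m invmx U \in borel)
  /\ U *m bmat a b x y z w *m invmx U = Tmx a b.
Proof.
case; rewrite !mulf_eq0 !negb_or => /andP[n2 a0] /andP[_ b0] amb apb.
(* Here p and q cancel the beta and alpha coordinates, then r and s cancel the two higher ones; each
   divisor is the value of the corresponding root. *)
pose p := y / (a - b); pose q := x / (2 * b); pose r := (z - y * q) / (a + b).
pose s := (w + p * z - y * (r + p * q)) / (2 * a) - p * r.
exists (unip p q r s); first exact: unip_Sp4.
split=> [X|]; first exact: unip_borel.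
rewrite unip_inv Tmx_bmat /unip /bmat !M4E /s /r /p /q; congr M4.
all: by field; rewrite ?n2 ?a0 ?b0 ?amb ?apb.
Qed.

End RegularElements.

(** * Classification *)

Section Classification.
Variable F : fieldType.
Implicit Types (X Y g h : 'M[F]_4) (S : {vspace 'M[F]_4}).

Lemma bmatD (a b x y z w a' b' x' y' z' w' : F) :
  bmat a b x y z w + bmat a' b' x' y' z' w' =
  bmat (a + a') (b + b') (x + x') (y + y') (z + z') (w + w').
Proof. by rewrite /bmat !M4E; congr M4; ring. Qed.

Lemma bmatZ (c a b x y z w : F) :
  c *: bmat a b x y z w = bmat (c * a) (c * b) (c * x) (c * y) (c * z) (c * w).
Proof. by rewrite /bmat !M4E; congr M4; ring. Qed.

Lemma bmatN (a b x y z w : F) :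
  - bmat a b x y z w = bmat (- a) (- b) (- x) (- y) (- z) (- w).
Proof. by rewrite /bmat !M4E; congr M4; ring. Qed.

Lemma mem_Tmx_part S (a b h k x y z w : F) : lie_subalgebra S ->
  regular a b -> Tmx a b \in S -> bmat h k x y z w \in S -> Tmx h k \in S.
Proof.
move=> [_ Sbr] [a0 b0 amb apb] TS VS.
(* [D] applies ad T - c: torus coordinates are multiplied by -c, each root coordinate by its root
   value minus c. *)
have D (c h' k' x' y' z' w' : F) : bmat h' k' x' y' z' w' \in S ->
  bmat (- c * h') (- c * k') ((2 * b - c) * x') ((a - b - c) * y')
    ((a + b - c) * z') ((2 * a - c) * w') \in S.
  move=> WS; have := memvB (Sbr _ _ TS WS) (memvZ c WS).
  rewrite Tmx_bmat bmat_bracket bmatZ bmatN bmatD.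
  by congr (_ \in S); congr bmat; ring.
have c0 : 2 * a * (2 * b) * (a - b) * (a + b) != 0.
  exact: mulf_neq0 (mulf_neq0 (mulf_neq0 a0 b0) amb) apb.
(* With c running through the four root values every root coordinate dies, and the torus part is
   multiplied by their product, the four signs cancelling. *)
have := memvZ (2 * a * (2 * b) * (a - b) * (a + b))^-1
  (D (2 * a) _ _ _ _ _ _ (D (a + b) _ _ _ _ _ _
    (D (a - b) _ _ _ _ _ _ (D (2 * b) _ _ _ _ _ _ VS)))).
move: c0; rewrite Tmx_bmat bmatZ !mulf_eq0 !negb_or.
move=> /andP[/andP[/andP[/andP[n2 a1] /andP[_ b1]] ab1] ab2].
by congr (_ \in S); congr bmat; field; rewrite ?n2 ?a1 ?b1 ?ab1 ?ab2.
Qed.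

(** Cramer's rule in the plane t. *)
Lemma Tmx_span S (a b h k : F) : a * k - b * h != 0 ->
  Tmx a b \in S -> Tmx h k \in S -> forall p q, Tmx p q \in S.
Proof.
move=> d0 TS TS' p q.
have := memvD (memvZ ((p * k - q * h) / (a * k - b * h)) TS)
  (memvZ ((q * a - p * b) / (a * k - b * h)) TS').
rewrite !Tmx_bmat !bmatZ bmatD.
by congr (_ \in S); congr bmat; field.
Qed.

Lemma proportional (x0 y0 x y : F) : (x0 != 0) || (y0 != 0) ->
  x * y0 = x0 * y -> exists u, x = u * x0 /\ y = u * y0.
Proof.
case: (eqVneq x0 0) => [->|x00] /= => [y00|_] E.
- by exists (y / y0); rewrite mulr0 divfK //; split=> //; apply: (mulIf y00); rewrite E !mul0r.
- exists (x / x0); rewrite divfK //; split=> //.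
  by apply: (mulfI x00); rewrite -E; field.
Qed.

Lemma Tmx_0 : Tmx 0 0 = 0 :> 'M[F]_4.
Proof. by rewrite /Tmx !scale0r !subr0 addr0. Qed.

(** Five independent elements, too many for a four-dimensional S that contains T and the whole
    nilradical. *)
Lemma free_Tmx_nil (a b : F) : a != 0 ->
  free [:: Tmx a b; X_alpha; X_beta; X_alpha_beta; X_alpha_2beta : 'M[F]_4].
Proof.
move=> a0; apply/(@freeP _ _ _ [tuple Tmx a b; X_alpha; X_beta; X_alpha_beta;
                                     X_alpha_2beta : 'M[F]_4]) => k.
rewrite !big_ord_recl big_ord0 addr0 /= !addrA TmxZ
  -(addrA (Tmx (k ord0 * a) (k ord0 * b))) bmatE.
rewrite /bmat M4_0 => /M4_inj[[/eqP + k2 k4 k3] [_ _ _ k1] _ _].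
rewrite mulf_eq0 (negPf a0) orbF => /eqP k0.
case=> [[|[|[|[|[|//]]]]]] lti; [rewrite -[RHS]k0 | rewrite -[RHS]k1
  | rewrite -[RHS]k2 | rewrite -[RHS]k3 | rewrite -[RHS]k4].
all: by congr k; apply: val_inj.
Qed.

Lemma classify_fam S (a b : F) : lie_subalgebra S -> (S <= borel)%VS ->
    \dim S = 4%N -> regular a b -> Tmx a b \in S ->
    ~ (forall p q, Tmx p q \in S) ->
  exists x y, (x != 0) || (y != 0) /\ S = fam a b x y.
Proof.
move=> Slie Sb S4 reg TS noT; have [_ Sbr] := Slie.
have [a20 b20 amb apb] := reg.
move: a20 b20; rewrite !mulf_eq0 !negb_or => /andP[n2 a0] /andP[_ b0].
(* By [Tmx_span], a torus part outside the line of T would put all of t into S. So every torus part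
   is a multiple of T and can be subtracted. *)
have part (h k x y z w : F) : bmat h k x y z w \in S ->
    exists c, [/\ h = c * a, k = c * b & bmat 0 0 x y z w \in S].
  move=> VS; have TV := mem_Tmx_part Slie reg TS VS.
  have [d0|d0] := eqVneq (a * k - b * h) 0; last by case: noT; apply: Tmx_span d0 _ _.
  exists (h / a); split; first by rewrite divfK.
    by move/eqP: d0; rewrite subr_eq0 => /eqP d0; apply: (mulfI a0); rewrite d0; field.
  have := memvB VS TV; rewrite Tmx_bmat bmatN bmatD.
  by congr (_ \in S); congr bmat; ring.
have [x0 [y0 [nz xy]]] : exists x0 y0, (x0 != 0) || (y0 != 0) /\
    forall x y z w, bmat 0 0 x y z w \in S -> x * y0 = x0 * y.
  have [[x0 [y0 [z0 [w0 [VS nz]]]]]|no] := pselect (exists x y z w,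
      bmat 0 0 x y z w \in S /\ (x != 0) || (y != 0)); last first.
    (* No nilpotent element of S has an alpha or beta coordinate here, so any nonzero pair
       serves. *)
    exists 1, 0; rewrite oner_eq0; split=> // x y z w VS.
    rewrite mulr0 mul1r; apply/esym; apply: contra_notP no => /eqP y0.
    by exists x, y, z, w; rewrite y0 orbT.
  exists x0, y0; split=> // x y z w V'S.
  apply: contra_notP noT => /eqP; rewrite -subr_eq0 => d0.
  (* Suppose two elements have independent (alpha, beta) parts, with determinant d. Their bracket
     has alpha + beta coordinate d, and the aim is to generate the whole nilradical. *)
  set d := x * y0 - x0 * y in d0.
  have [W0 WS] : exists w', bmat 0 0 0 0 d w' \in S.
    have := Sbr _ _ VS V'S; rewrite bmat_bracket => W; eexists; move: W.
    by congr (_ \in S); congr bmat; rewrite /d; try ring.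
  (* Bracketing with an element of nonzero beta coordinate reaches alpha + 2 beta; as d is nonzero,
     one of the two elements qualifies. *)
  have E1 : bmat 0 0 0 0 0 1 \in S.
    have bW x1 y1 z1 w1 : bmat 0 0 x1 y1 z1 w1 \in S -> y1 != 0 ->
        bmat 0 0 0 0 0 1 \in S.
      move=> V1S y10; have := memvZ (2 * y1 * d)^-1 (Sbr _ _ V1S WS).
      rewrite bmat_bracket bmatZ.
      by congr (_ \in S); congr bmat; field; rewrite ?n2 ?y10 ?d0.
    have [y00|] := eqVneq y0 0; last exact: bW VS.
    apply: bW V'S _; apply: contra_neq d0 => y0'.
    by rewrite /d y00 y0' !mulr0 subrr.
  have E2 : bmat 0 0 0 0 1 0 \in S.
    have := memvB (memvZ d^-1 WS) (memvZ (d^-1 * W0) E1).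
    rewrite !bmatZ bmatN bmatD.
    by congr (_ \in S); congr bmat; field.
  (* Cramer's rule produces the part (x1, y1); [E1] and [E2] clear the other coordinates. *)
  have E3 (x1 y1 : F) : bmat 0 0 x1 y1 0 0 \in S.
    have := memvD (memvZ ((x1 * y - y1 * x) / - d) VS)
      (memvZ ((x1 * y0 - y1 * x0) / d) V'S).
    move=> /memvB /(_ (memvZ ((x1 * y - y1 * x) / - d * z0
      + (x1 * y0 - y1 * x0) / d * z) E2)).
    move=> /memvB /(_ (memvZ ((x1 * y - y1 * x) / - d * w0
      + (x1 * y0 - y1 * x0) / d * w) E1)).
    rewrite !bmatZ bmatD bmatN bmatD bmatN bmatD.
    by congr (_ \in S); congr bmat; rewrite /d; field; rewrite oppr_eq0 d0.
  suff: (5 <= \dim S)%N by rewrite S4.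
  have := free_Tmx_nil b a0; rewrite /free /= => /eqP <-.
  apply/dimvS/span_subvP => X.
  rewrite !inE => /or4P[/eqP->//|/eqP->|/eqP->|/orP[/eqP->|/eqP->]].
  - by have := E3 1 0; rewrite -bmatE Tmx_0 !scale0r scale1r !addr0 add0r.
  - by have := E3 0 1; rewrite -bmatE Tmx_0 !scale0r scale1r !addr0 !add0r.
  - by have := E2; rewrite -bmatE Tmx_0 !scale0r scale1r !addr0 !add0r.
  - by have := E1; rewrite -bmatE Tmx_0 !scale0r scale1r !addr0 !add0r.
(* One inclusion suffices, since [fam] has dimension at most four. *)
exists x0, y0; split=> //; apply/eqP; rewrite eqEdim S4 dim_fam andbT.
apply/subvP => V VS; have /borel_bmat[h [k [x [y [z [w VE]]]]]] := subvP Sb _ VS.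
move: VS; rewrite VE => /part[c [-> -> /xy /(proportional nz)[u [-> ->]]]].
by apply/mem_fam; exists c, u, z, w.
Qed.


(** * Normalization by the torus and the Weyl group *)

Lemma fam_scale (c d a b x y : F) : c != 0 -> d != 0 ->
  fam (c * a) (c * b) (d * x) (d * y) = fam a b x y.
Proof.
move=> c0 d0; apply/vspaceP => X; apply/idP/idP => /mem_fam[e [u [z [w ->]]]].
  by apply/mem_fam; exists (e * c), (u * d), z, w; rewrite !mulrA.
apply/mem_fam; exists (e / c), (u / d), z, w.
by rewrite !mulrA !divfK.
Qed.

(** This torus element fixes the alpha coordinate and scales the beta one, so the ratio of two
    nonzero coordinates can be adjusted at will. *)
Lemma conj_torus (s a b x y z w : F) : s != 0 ->
  let g := M4 s 0 0 0 0 1 0 0 0 0 s^-1 0 0 0 0 1 in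
  g *m bmat a b x y z w *m invmx g
    = bmat a b x (s * y) (s * z) (s * s * w).
Proof.
move=> s0 g; rewrite (@invmx_eq _ g (M4 s^-1 0 0 0 0 1 0 0 0 0 s 0 0 0 0 1)).
  by rewrite /g /bmat !M4E; congr M4; field.
by rewrite /g M4E M4_1; congr M4; field.
Qed.

Lemma Sp4_equiv_refl S : Sp4_equiv S S.
Proof.
exists 1%:M; first by apply/andP; rewrite unitmx1 trmx1 mulmx1 mul1mx.
by move=> Y; rewrite invmx1; split=> [YS|[X XS ->]]; [exists Y|]; rewrite ?mul1mx ?mulmx1.
Qed.

Lemma Sp4P g h : g *m h = 1%:M -> g *m J4 *m g^T = J4 -> g \in Sp4.
Proof.
move=> gh gJ; apply/andP; split; last exact/eqP.
by case: (mulmx1_unit gh).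
Qed.

Lemma torus_Sp4 (s : F) : s != 0 ->
  M4 s 0 0 0 0 1 0 0 0 0 s^-1 0 0 0 0 1 \in Sp4.
Proof.
move=> s0; apply: (@Sp4P _ (M4 s^-1 0 0 0 0 1 0 0 0 0 s 0 0 0 0 1)).
  by rewrite M4E M4_1; congr M4; field.
by rewrite M4_J !M4E; congr M4; field.
Qed.

Lemma torus_equiv (s a b x y : F) : s != 0 ->
  Sp4_equiv (fam a b x y) (fam a b x (s * y)).
Proof.
move=> s0; have gS := torus_Sp4 s0.
apply: (Sp4_equiv_of gS) => _ /mem_fam[c [u [z [w ->]]]].
  rewrite conj_torus //; apply/mem_fam.
  by exists c, u, (s * z), (s * s * w); rewrite (mulrCA s).
have -> : bmat (c * a) (c * b) (u * x) (u * (s * y)) z w =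
    bmat (c * a) (c * b) (u * x) (s * (u * y)) (s * (z / s)) (s * s * (w / (s * s))).
  by congr bmat; field.
rewrite -conj_torus // conjK ?Sp4_unit //; apply/mem_fam.
by exists c, u, (z / s), (w / (s * s)).
Qed.

(** Represents the reflection in beta, which swaps a and b and also the roots alpha and alpha + 2
    beta. *)
Definition weyl12 : 'M[F]_4 := M4 0 1 0 0 1 0 0 0 0 0 0 1 0 0 1 0.

(** Represents the reflection in alpha, which negates b and swaps beta and alpha + beta. *)
Definition weyl2 : 'M[F]_4 := M4 1 0 0 0 0 0 0 1 0 0 1 0 0 (-1) 0 0.

Lemma weyl12_mul : weyl12 *m weyl12 = 1%:M.
Proof. by rewrite /weyl12 M4E M4_1; congr M4; ring. Qed.

Lemma weyl2_mul : weyl2 *m M4 1 0 0 0 0 0 0 (-1) 0 0 1 0 0 1 0 0 = 1%:M.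
Proof. by rewrite /weyl2 M4E M4_1; congr M4; ring. Qed.

Lemma weyl12_Sp4 : weyl12 \in Sp4.
Proof.
by apply: (Sp4P weyl12_mul); rewrite /weyl12 M4_J !M4E; congr M4; ring.
Qed.

Lemma weyl2_Sp4 : weyl2 \in Sp4.
Proof.
by apply: (Sp4P weyl2_mul); rewrite /weyl2 M4_J !M4E; congr M4; ring.
Qed.

Lemma conj_weyl12 (a b x z w : F) :
  weyl12 *m bmat a b x 0 z w *m weyl12 = bmat b a w 0 z x.
Proof. by rewrite /weyl12 /bmat !M4E; congr M4; ring. Qed.

Lemma conj_weyl2 (a b y z w : F) :
  weyl2 *m bmat a b 0 y z w *m invmx weyl2 = bmat a (- b) 0 z (- y) w.
Proof.
by rewrite (invmx_eq weyl2_mul) /weyl2 /bmat !M4E; congr M4; ring.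
Qed.

Lemma fam_np_inv (a : F) : a != 0 ->
  Sp4_equiv (fam a 1 1 0) (fam a^-1 1 1 0).
Proof.
move=> a0; have iE := invmx_eq weyl12_mul.
have sub (b : F) X : b != 0 -> X \in fam b 1 1 0 ->
    weyl12 *m X *m weyl12 \in fam b^-1 1 1 0.
  move=> b0 /mem_fam[c [u [z [w ->]]]]; rewrite mulr0 conj_weyl12.
  (* T_{b,1} goes to T_{1,b}, which is b times T_{1/b,1}. *)
  apply/mem_fam; exists (c * b), w, z, (u * 1).
  by congr bmat; field.
apply: (Sp4_equiv_of weyl12_Sp4) => X XS; rewrite iE; first exact: sub.
by rewrite -[a]invrK; apply: sub; rewrite ?invr_eq0.
Qed.

Lemma fam_beta_opp (a : F) : Sp4_equiv (fam a 1 0 1) (fam (- a) 1 0 1).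
Proof.
apply: (Sp4_equiv_of weyl2_Sp4) => _ /mem_fam[c [u [z [w ->]]]].
  rewrite mulr0 conj_weyl2; apply/mem_fam; exists (- c), z, (- (u * 1)), w.
  by congr bmat; ring.
have -> : bmat (c * - a) (c * 1) (u * 0) (u * 1) z w =
  bmat (- c * a) (- (- c * 1)) 0 u (- - z) w by congr bmat; ring.
rewrite -conj_weyl2 conjK ?Sp4_unit ?weyl2_Sp4 //.
by apply/mem_fam; exists (- c), (- z), u, w; congr bmat; ring.
Qed.

Lemma classification S : lie_subalgebra S -> (S <= borel)%VS ->
    \dim S = 4%N -> (exists2 X, X \in S & regular_semisimple X) ->
    ~ (exists2 H, cartan_subalgebra H & (H <= S)%VS) ->
  [\/ exists2 a : F, admissible a & Sp4_equiv S (fam a 1 1 0),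
      exists2 a : F, admissible a & Sp4_equiv S (fam a 1 0 1)
    | Sp4_equiv S (fam 3 1 1 1)].
Proof.
move=> Slie Sb S4 [X XS Xreg] noH.
have [a [b [x [y [z [w XE]]]]]] := borel_bmat (subvP Sb _ XS).
move: XS Xreg; rewrite {}XE => XS /regular_bmat/uniq_regular reg.
have [g gS [gb gX]] := conj_regular x y z w reg.
have S'b : (conjS g S <= borel)%VS.
  by apply/subvP => _ /mem_conjS[Y YS ->]; apply/gb/(subvP Sb).
have TS : Tmx a b \in conjS g S by apply/mem_conjS; exists (bmat a b x y z w).
have [] := classify_fam (lie_conjS gS Slie) S'b _ reg TS (no_cartan_Tmx gS noH).
  by rewrite dim_conjS // Sp4_unit.
move=> x0 [y0 [nz SE]].
have := Sp4_equiv_conjS S gS; rewrite SE => SQ.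
have [] := reg; rewrite !mulf_eq0 !negb_or => /andP[n2 a0] /andP[_ b0] amb apb.
(* Dividing T by b gives the parameter a / b; regularity excludes 0, 1 and -1. *)
have adm : admissible (a / b).
  split; first by rewrite mulf_neq0 ?invr_eq0.
    by apply: contra_neq amb => E; rewrite -(divfK b0 a) E mul1r subrr.
  by apply: contra_neq apb => E; rewrite -(divfK b0 a) E mulN1r addNr.
have normE (x1 y1 e : F) : e != 0 -> fam a b (e * x1) (e * y1) = fam (a / b) 1 x1 y1.
  by move=> e0; rewrite -[RHS](fam_scale _ _ _ _ b0 e0) mulr1 (mulrC b) divfK.
have [x00|x00] := eqVneq x0 0.
  constructor 2; exists (a / b) => //.
  move: nz SQ; rewrite x00 eqxx /= => y00.
  by have := normE 0 1 y0 y00; rewrite mulr0 mulr1 => ->.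
have [y00|y00] := eqVneq y0 0.
  constructor 1; exists (a / b) => //; move: SQ.
  by have := normE 1 0 x0 x00; rewrite y00 mulr0 mulr1 => ->.
constructor 3.
(* The bracket of T with x0 X_alpha + y0 X_beta must be proportional to it modulo [n, n], so the
   root values 2b and a - b agree. *)
have a3b : a = 3 * b.
  have [_ br] := lie_conjS gS Slie.
  have VS : bmat 0 0 x0 y0 0 0 \in conjS g S.
    by rewrite SE; apply/mem_fam; exists 0, 1, 0, 0; congr bmat; ring.
  have := br _ _ TS VS; rewrite SE Tmx_bmat bmat_bracket => /mem_fam[c [u [z' [w']]]].
  case/M4_inj=> [[_ Ey _ _] [_ _ _ Ex] _ _].
  have u2b : u = 2 * b by apply: (mulIf x00); rewrite -Ex; ring.
  have uab : u = a - b by apply: (mulIf y00); rewrite -Ey; ring.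
  by rewrite -[a](subrK b) -uab u2b; ring.
apply: Sp4_equiv_trans SQ _.
(* Scaling by x0 / y0 turns (x0, y0) into (x0, x0), a multiple of (1, 1). *)
have s0 : x0 / y0 != 0 by rewrite mulf_neq0 ?invr_eq0.
apply: Sp4_equiv_trans (torus_equiv _ _ _ _ s0) _.
have := normE 1 1 x0 x00; rewrite divfK // mulr1 => ->; rewrite a3b mulfK //.
exact: Sp4_equiv_refl.
Qed.

End Classification.

(** * Equivalences among the listed subalgebras *)

Section Inequivalence.
Variable F : fieldType.
Implicit Types (X Y g h : 'M[F]_4) (S : {vspace 'M[F]_4}).

(** For 4 x 4 matrices this is nilpotency. *)
Definition nil4 X := X *m X *m X *m X = 0.

Lemma nil4_conj g X : g \in unitmx -> nil4 (g *m X *m invmx g) <-> nil4 X.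
Proof.
move=> gu; have E : g *m X *m invmx g *m (g *m X *m invmx g) *m
    (g *m X *m invmx g) *m (g *m X *m invmx g) =
    g *m (X *m X *m X *m X) *m invmx g.
  by rewrite !mulmxA !mulmxKV.
rewrite /nil4 E; split=> [X0|->]; last by rewrite mulmx0 mul0mx.
by rewrite -[LHS](conjK _ gu) X0 mulmx0 mul0mx.
Qed.

Lemma nil4_bmat (x y z w : F) : nil4 (bmat 0 0 x y z w).
Proof. by rewrite /nil4 /bmat !M4E M4_0; congr M4; ring. Qed.

(** The coefficient c of [Tmx a 1] is the (2,2) entry of X, and the (2,2) entry of X^4 is c^4. *)
Lemma fam_nil4 (a x y : F) X : X \in fam a 1 x y -> nil4 X ->
  exists u z w, X = bmat 0 0 (u * x) (u * y) z w.
Proof.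
case/mem_fam=> c [u [z [w ->]]].
rewrite /nil4 /bmat !M4E M4_0 => /M4_inj[_ [_ c4 _ _] _ _].
have : c ^+ 4 = 0 by rewrite -c4; ring.
by move/eqP; rewrite expf_eq0 => /eqP->; exists u, z, w; rewrite !mul0r.
Qed.

Lemma Sp4_equiv_nil4 S S' Y : Sp4_equiv S S' -> Y \in S' -> nil4 Y ->
  exists g X, [/\ g \in Sp4, X \in S, nil4 X & Y = g *m X *m invmx g].
Proof.
case=> g gS SS' /SS'[X XS ->] /(nil4_conj _ (Sp4_unit gS)) nX.
by exists g, X.
Qed.

Lemma np_bmat_mul (x z w x' z' w' : F) :
  bmat 0 0 x 0 z w *m bmat 0 0 x' 0 z' w' = 0.
Proof. by rewrite /bmat !M4E M4_0; congr M4; ring. Qed.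

Lemma beta_bmat_sqr (y z w : F) : bmat 0 0 0 y z w *m bmat 0 0 0 y z w = 0.
Proof. by rewrite /bmat !M4E M4_0; congr M4; ring. Qed.

(** [X_beta] and [X_alpha_beta] would both be conjugated into n_p, where all products vanish, yet
    their product is E_{13}. *)
Lemma np_not_beta (a a' : F) : ~ Sp4_equiv (fam a 1 1 0) (fam a' 1 0 1).
Proof.
case=> g gS SS'; have gu := Sp4_unit gS.
have pull (y z : F) : exists x z' w',
    bmat 0 0 0 y z 0 = g *m bmat 0 0 x 0 z' w' *m invmx g.
  have /SS'[X XS E] : bmat 0 0 0 y z 0 \in fam a' 1 0 1.
    by apply/mem_fam; exists 0, y, z, 0; congr bmat; ring.
  have /(nil4_conj _ gu) nX : nil4 (g *m X *m invmx g) by rewrite -E; apply: nil4_bmat.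
  have [u [z' [w' XE]]] := fam_nil4 XS nX.
  by exists u, z', w'; rewrite E XE mulr1 mulr0.
have [x1 [z1 [w1 E1]]] := pull 1 0.
have [x2 [z2 [w2 E2]]] := pull 0 1.
have : bmat 0 0 0 1 0 0 *m bmat 0 0 0 0 1 0 = 0 :> 'M[F]_4.
  rewrite E1 E2 !mulmxA mulmxKV // -(mulmxA g) np_bmat_mul.
  by rewrite mulmx0 mul0mx.
rewrite /bmat M4E M4_0 => /M4_inj[[_ _ E _] _ _ _].
by have := oner_neq0 F; rewrite -[X in X != _]addr0 -[X in _ != X]E; case/eqP; ring.
Qed.

Lemma mixed_sqr_neq0 : bmat 0 0 1 1 0 0 *m bmat 0 0 1 1 0 0 <> 0 :> 'M[F]_4.
Proof.
rewrite /bmat M4E M4_0 => /M4_inj[[_ _ _ E] _ _ _].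
by have := oner_neq0 F; rewrite -[X in _ != X]E; case/eqP; ring.
Qed.

Lemma not_mixed (a x y b : F) : x = 0 \/ y = 0 ->
  ~ Sp4_equiv (fam a 1 x y) (fam b 1 1 1).
Proof.
move=> xy0 /Sp4_equiv_nil4 => /(_ (bmat 0 0 1 1 0 0)) [||g [X [gS XS nX E]]].
- by apply/mem_fam; exists 0, 1, 0, 0; congr bmat; ring.
- exact: nil4_bmat.
apply: mixed_sqr_neq0; have gu := Sp4_unit gS.
have [u [z [w XE]]] := fam_nil4 XS nX.
have X2 : X *m X = 0.
  rewrite XE; case: xy0 => ->; rewrite mulr0; first exact: beta_bmat_sqr.
  exact: np_bmat_mul.
by rewrite E !mulmxA mulmxKV // -(mulmxA g) X2 mulmx0 mul0mx.
Qed.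

(** Written without the inverse of g, the relation is linear in the entries of g. *)
Lemma nil4_image (a x y a' x' y' : F) g X : g \in Sp4 ->
    (forall Y, Y \in fam a' 1 x' y' <->
       exists2 X, X \in fam a 1 x y & Y = g *m X *m invmx g) ->
    X \in fam a 1 x y -> nil4 X ->
  exists u z w, g *m X = bmat 0 0 (u * x') (u * y') z w *m g.
Proof.
move=> gS SS' XS nX; have gu := Sp4_unit gS.
have YS : g *m X *m invmx g \in fam a' 1 x' y' by apply/SS'; exists X.
have [|u [z [w E]]] := fam_nil4 YS; first exact/nil4_conj.
by exists u, z, w; rewrite -E mulmxKV.
Qed.

Definition simp01 := (@mulr0 F, @mul0r F, @mulr1 F, @mul1r F, @addr0 F, @add0r F,
  @oppr0 F, @mulrN1 F, @mulN1r F, @sub0r F, @subr0 F).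

(** * Recovering the parameter within each family *)

Lemma np_equiv (a a' : F) : Sp4_equiv (fam a 1 1 0) (fam a' 1 1 0) ->
  a' = a \/ a' = a^-1.
Proof.
case=> g gS SS'; have gu := Sp4_unit gS.
have cn x z w : exists x' z' w', g *m bmat 0 0 x 0 z w = bmat 0 0 x' 0 z' w' *m g.
  have [||u [z' [w' E]]] := @nil4_image a 1 0 a' 1 0 g (bmat 0 0 x 0 z w) gS SS'.
  - by apply/mem_fam; exists 0, x, z, w; congr bmat; ring.
  - exact: nil4_bmat.
  by exists (u * 1), z', w'; rewrite E mulr0.
have [c [u [z [w gT]]]] : exists c u z w,
    g *m bmat a 1 0 0 0 0 = bmat (c * a') c u 0 z w *m g.
  have : g *m bmat a 1 0 0 0 0 *m invmx g \in fam a' 1 1 0.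
    apply/SS'; exists (bmat a 1 0 0 0 0) => //.
    by apply/mem_fam; exists 1, 0, 0, 0; congr bmat; ring.
  case/mem_fam=> c [u [z [w E]]]; exists c, u, z, w.
  by move: E; rewrite !(mulr1, mulr0) => <-; rewrite mulmxKV.
have [x1 [z1 [w1 E1]]] := cn 1 0 0.
have [x2 [z2 [w2 E2]]] := cn 0 0 1.
have /andP[_ /eqP gJ] := gS.
have [g11 [g12 [g13 [g14 [g21 [g22 [g23 [g24 [g31 [g32 [g33 [g34
  [g41 [g42 [g43 [g44 gE]]]]]]]]]]]]]]]] := M4_ex g.
move: E1 E2 gT gJ; rewrite {}gE /bmat M4_J M4_tr !M4_mul !simp01.
(* Rows three and four of elements of n_p vanish, which makes g block upper triangular: it preserves
   the span of e_1 and e_2. *)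
case/M4_inj=> [_ _ [_ _ _ g32_0] [_ _ _ g42_0]].
case/M4_inj=> [_ _ [_ _ g31_0 _] [_ _ g41_0 _]].
case/M4_inj=> [[T11 T12 _ _] [T21 T22 _ _] _ _].
case/M4_inj=> [[_ _ J13 J14] [_ _ J23 J24] _ _].
move: T11 T12 T21 T22 J13 J14 J23 J24.
rewrite g31_0 g32_0 g41_0 g42_0 !simp01 => T11 T12 T21 T22 J13 J14 J23 J24.
(* For the diagonal blocks A and D of g the symplectic condition gives A D^T = 1, so det A is
   nonzero and g11 g22 or g12 g21 is nonzero. Thus A matches the eigenvalues a, 1 with c a', c in
   one order or the other. *)
have det1 : (g33 * g44 - g34 * g43) * (g11 * g22 - g12 * g21) = 1.
  transitivity ((g11 * g33 + g12 * g34) * (g21 * g43 + g22 * g44)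
    - (g21 * g33 + g22 * g34) * (g11 * g43 + g12 * g44)); first by ring.
  by rewrite J13 J24 J23 mul0r subr0 mulr1.
have [E|d0] := eqVneq (g11 * g22) 0; last first.
  left; move: d0; rewrite mulf_eq0 negb_or => /andP[g11_0 g22_0].
  have c1 : c = 1 by apply: (mulIf g22_0); rewrite mul1r -T22.
  by apply: (mulfI g11_0); rewrite T11 c1; ring.
right.
have : g12 * g21 != 0.
  by apply: contra_eq_neq det1 => E'; rewrite E E' subrr mulr0 eq_sym oner_eq0.
rewrite mulf_eq0 negb_or => /andP[g12_0 g21_0].
have ca : c = a by apply: (mulIf g21_0); rewrite -T21 mulrC.
have aa' : a * a' = 1 by apply: (mulIf g12_0); rewrite mul1r -ca -T12.
have a0 : a != 0 by apply: contra_eq_neq aa' => ->; rewrite mul0r eq_sym oner_eq0.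
by apply: (mulfI a0); rewrite aa' mulfV.
Qed.

Lemma beta_equiv (a a' : F) : Sp4_equiv (fam a 1 0 1) (fam a' 1 0 1) ->
  a' = a \/ a' = - a.
Proof.
case=> g gS SS'; have gu := Sp4_unit gS.
have cn y z w : exists y' z' w', g *m bmat 0 0 0 y z w = bmat 0 0 0 y' z' w' *m g.
  have [||u [z' [w' E]]] := @nil4_image a 0 1 a' 0 1 g (bmat 0 0 0 y z w) gS SS'.
  - by apply/mem_fam; exists 0, y, z, w; congr bmat; ring.
  - exact: nil4_bmat.
  by exists (u * 1), z', w'; rewrite E mulr0.
have [c [u [z [w gT]]]] : exists c u z w,
    g *m bmat a 1 0 0 0 0 = bmat (c * a') c 0 u z w *m g.
  have : g *m bmat a 1 0 0 0 0 *m invmx g \in fam a' 1 0 1.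
    apply/SS'; exists (bmat a 1 0 0 0 0) => //.
    by apply/mem_fam; exists 1, 0, 0, 0; congr bmat; ring.
  case/mem_fam=> c [u [z [w E]]]; exists c, u, z, w.
  by move: E; rewrite !(mulr1, mulr0) => <-; rewrite mulmxKV.
have [y1 [z1 [w1 E1]]] := cn 1 0 0.
have [y2 [z2 [w2 E2]]] := cn 0 1 0.
have [y3 [z3 [w3 E3]]] := cn 0 0 1.
have /andP[_ /eqP gJ] := gS.
have [g11 [g12 [g13 [g14 [g21 [g22 [g23 [g24 [g31 [g32 [g33 [g34
  [g41 [g42 [g43 [g44 gE]]]]]]]]]]]]]]]] := M4_ex g.
move: E1 E2 E3 gT gJ; rewrite {}gE /bmat M4_J M4_tr !M4_mul !simp01.
(* Row three of a nilpotent element of the target is zero, so row three of g is supported on its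
   third entry; the symplectic relations then make g preserve the line of e_1. *)
case/M4_inj=> [_ _ [_ _ g34_0 _] _].
case/M4_inj=> [_ _ [_ _ g32_0 _] _].
case/M4_inj=> [_ _ [_ _ g31_0 _] _].
case/M4_inj=> [[T11 _ _ _] [_ T22 _ T24] _ _].
case/M4_inj=> [[_ _ J13 _] [_ _ J23 J24] _ [_ _ J43 _]].
move: T11 T22 T24 J13 J23 J43 J24.
have {}g34_0 : g34 = 0 by apply: oppr_inj; rewrite g34_0 oppr0.
rewrite g31_0 g32_0 g34_0 !simp01 => T11 T22 T24 J13 J23 J43.
have g33_0 : g33 != 0 by apply: contra_eq_neq J13 => ->; rewrite mulr0 eq_sym oner_eq0.
have g11_0 : g11 != 0 by apply: contra_eq_neq J13 => ->; rewrite mul0r eq_sym oner_eq0.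
have g21_0 : g21 = 0 by apply: (mulIf g33_0); rewrite J23 mul0r.
have g41_0 : g41 = 0 by apply: (mulIf g33_0); rewrite J43 mul0r.
move: T11 T22 T24; rewrite g21_0 g41_0 !simp01 => T11 T22 T24 J24.
have ca : a = c * a' by apply: (mulfI g11_0); rewrite T11 mulrC.
(* By [J24], g22 or g24 is nonzero; T acts by 1 on e_2 and by -1 on e_4, hence c = 1 or c = -1. *)
have [g22_0|g22_0] := eqVneq g22 0; last first.
  have c1 : c = 1 by apply: (mulIf g22_0); rewrite mul1r.
  by left; rewrite ca c1 mul1r.
right; have g24_0 : g24 != 0.
  by apply: contra_eq_neq J24 => ->; rewrite g22_0 !simp01 eq_sym oner_eq0.
have c1 : c = -1 by apply: (mulIf g24_0); rewrite mulN1r.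
by rewrite ca c1 mulN1r opprK.
Qed.

End Inequivalence.

Local Open Scope complex_scope.

Theorem theorem8p2 (R : realType) :
  (* the listed spans are subalgebras *)
  [/\ forall a : R[i], admissible a -> lie_subalgebra (fam_np a),
      forall a : R[i], admissible a -> lie_subalgebra (fam_beta a)
    & lie_subalgebra (alg_mixed : {vspace 'M[R[i]]_4})] /\
  (* every subalgebra of the given kind is equivalent to a listed one *)
  (forall S : {vspace 'M[R[i]]_4},
     lie_subalgebra S -> (S <= borel)%VS -> \dim S = 4%N ->
     (exists2 X, X \in S & regular_semisimple X) ->
     ~ (exists2 H : {vspace 'M[R[i]]_4}, cartan_subalgebra H & (H <= S)%VS) ->
     [\/ exists2 a : R[i], admissible a & Sp4_equiv S (fam_np a),
         exists2 a : R[i], admissible a & Sp4_equiv S (fam_beta a)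
       | Sp4_equiv S alg_mixed]) /\
  (* the equivalences among the listed subalgebras are exactly those noted *)
  [/\ forall a a' : R[i], admissible a -> admissible a' ->
        (Sp4_equiv (fam_np a) (fam_np a') <-> a' = a \/ a' = a^-1),
      forall a a' : R[i], admissible a -> admissible a' ->
        (Sp4_equiv (fam_beta a) (fam_beta a') <-> a' = a \/ a' = - a),
      forall a a' : R[i], admissible a -> admissible a' ->
        ~ Sp4_equiv (fam_np a) (fam_beta a'),
      forall a : R[i], admissible a -> ~ Sp4_equiv (fam_np a) alg_mixed
    & forall a : R[i], admissible a -> ~ Sp4_equiv (fam_beta a) alg_mixed].
Proof.
split; [split=> [a [a0 a1 aN1]|a [a0 a1 aN1]|] | split].
- by rewrite fam_npE; apply: lie_fam; constructor 2.
- by rewrite fam_betaE; apply: lie_fam; constructor 1.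
- by rewrite alg_mixedE; apply: lie_fam; constructor 3; rewrite mulr1.
- move=> S Slie Sb S4 Sreg noH; rewrite alg_mixedE.
  case: (classification Slie Sb S4 Sreg noH) => [[a adm ?]|[a adm ?]|?].
  + by constructor 1; exists a; rewrite ?fam_npE.
  + by constructor 2; exists a; rewrite ?fam_betaE.
  + by constructor 3.
split=> [a a' [a0 _ _] _|a a' _ _|a a' _ _|a _|a _].
- rewrite !fam_npE; split=> [|[->|->]]; first exact: np_equiv.
    exact: Sp4_equiv_refl.
  exact: fam_np_inv.
- rewrite !fam_betaE; split=> [|[->|->]]; first exact: beta_equiv.
    exact: Sp4_equiv_refl.
  exact: fam_beta_opp.
- by rewrite fam_npE fam_betaE; apply: np_not_beta.
- by rewrite fam_npE alg_mixedE; apply: not_mixed; right.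
- by rewrite fam_betaE alg_mixedE; apply: not_mixed; left.
Qed.
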